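(* Let $(T,d,\rho)$ be a compact rooted real tree such that $\overline{\mathrm{Lf}(T)}=T$, and let $\leq_{\mathrm{Sh}}$ be the random uniform shuffling of $T$ (defined in the context). Then almost surely, for any finite Borel measure $\mu$ on $T$ whose topological support is $T$, the height function $h_{\mathrm{Sh}}$ associated with the structured tree $(T,d,\rho,\leq_{\mathrm{Sh}},\mu)$, i.e. the unique $h\in\mathcal{H}$ satisfying (Min) such that $(T_h,d_h,\rho_h,\leq_h,\mu_h)$ is equivalent to $(T,d,\rho,\leq_{\mathrm{Sh}},\mu)$, is continuous.
   Context: **Real trees.** A real tree is a metric space $(T,d)$ in which any two points $\sigma,\sigma'$ are joined by a path isometric to $[0,d(\sigma,\sigma')]$, with image denoted $[\![\sigma,\sigma']\!]$, and such that every continuous injective $q:[0,1]\to T$ has image $[\![q(0),q(1)]\!]$. It is rooted if a point $\rho\in T$ is distinguished. The point $\sigma\wedge\sigma'$ is defined by $[\![\rho,\sigma\wedge\sigma']\!]=[\![\rho,\sigma]\!]\cap[\![\rho,\sigma']\!]$. $\mathrm{Lf}(T)$ (resp. $\mathrm{Br}(T)$) is the set of $\sigma\in T\setminus\{\rho\}$ such that $T\setminus\{\sigma\}$ has exactly one (resp. at least $3$) connected components; $\mathrm{Br}(T)$ is at most countable. **Random uniform shuffling.** For $\sigma\in T$, let $\mathcal{C}_\sigma$ be the (at most countable) set of connected components of $T\setminus\{\sigma\}$ that do not contain $\rho$; fix an index set $I_\sigma$ equal to $\emptyset$, $\{1,\dots,n\}$ or $\{1,2,\dots\}$, and a bijection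 $k\mapsto C_\sigma(k)$ from $I_\sigma$ onto $\mathcal{C}_\sigma$. Let $\{U_{\sigma,k}:\sigma\in\mathrm{Br}(T)\cup\{\rho\},\ k\in I_\sigma\}$ be i.i.d. random variables uniform on $[0,1]$ and let $k\lhd_\sigma l$ iff $U_{\sigma,k}\leq U_{\sigma,l}$ (a.s. a linear order on $I_\sigma$). The (reflexive) order $\leq_{\mathrm{Sh}}$ on $T$ is defined for distinct $\sigma,\sigma'$ by: if $\sigma\wedge\sigma'\in\{\sigma,\sigma'\}$, then $\sigma\leq_{\mathrm{Sh}}\sigma'$ if $\sigma\in[\![\rho,\sigma']\!]$ and $\sigma'\leq_{\mathrm{Sh}}\sigma$ if $\sigma'\in[\![\rho,\sigma]\!]$; otherwise $\sigma\wedge\sigma'\in\mathrm{Br}(T)\cup\{\rho\}$, there are distinct $k,k'\in I_{\sigma\wedge\sigma'}$ with $\sigma\in C_{\sigma\wedge\sigma'}(k)$, $\sigma'\in C_{\sigma\wedge\sigma'}(k')$, and $\sigma\leq_{\mathrm{Sh}}\sigma'$ if $k\lhd_{\sigma\wedge\sigma'}k'$, $\sigma'\leq_{\mathrm{Sh}}\sigma$ if $k'\lhd_{\sigma\wedge\sigma'}k$. **Structured trees.** A structured compact real tree $(T,d,\rho,\leq,\mu)$ is a rooted compact real tree with a linear order $\leq$ and a finite Borel measure $\mu$. Two such trees $(T,d,\rho,\leq,\mu)$, $(T',d',\rho',\leq',\mu')$ are equivalent if there is an isometry $f$ from $T$ onto $T'$ with $f(\rho)=\rho'$, $f(\sigma_1)\leq'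 f(\sigma_2)$ whenever $\sigma_1\leq\sigma_2$, and $\mu'=\mu\circ f^{-1}$. **Height functions and coding.** For $M\geq 0$, $\mathcal{H}_M$ is the set of non-negative functions $h$ on $[0,M]$, left-continuous with right-limits, with $h(0)=h(0+)=0$ and $h(t)-h(t+)\geq 0$ for $t\in[0,M)$; $\mathcal{H}=\bigcup_M\mathcal{H}_M$, $\zeta(h)=M$. For $h\in\mathcal{H}_M$ set $d_h(s,t)=h(s)+h(t)-2\inf_{r\in[s\wedge t,s\vee t]}h(r)$, $s\sim_h t$ iff $d_h(s,t)=0$, $T_h=[0,M]/\sim_h$ with induced distance $d_h$ (a compact real tree), $p_h:[0,M]\to T_h$ the projection, $\rho_h=p_h(0)$, $\sigma\leq_h\sigma'$ iff $\inf p_h^{-1}(\{\sigma\})\leq\inf p_h^{-1}(\{\sigma'\})$, and $\mu_h(A)=\lambda(p_h^{-1}(A))$ with $\lambda$ Lebesgue measure. **(Min).** For $\sigma\in T_h$ let $\ell(\sigma)=\inf p_h^{-1}(\{\sigma\})$, $r(\sigma)=\inf\{t>\ell(\sigma):p_h(t)\neq\sigma\}$ ($t\in[0,\zeta(h)]$, $\inf\emptyset=\zeta(h)$), $F(h)=\bigcup_{\sigma}[\ell(\sigma),r(\sigma)]$, $S(h)=[0,\zeta(h)]\setminus F(h)$; (Min) means $\lambda(S(h))=0$. **Known facts.** Say that a linear order $\leq$ satisfies (Or1) if $\sigma_1\in[\![\rho,\sigma_2]\!]$ implies $\sigma_1\leq\sigma_2$; (Or2) if $\sigma_1\leq\sigma_2\leq\sigma_3$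 implies $\gamma\in[\![\rho,\sigma_2]\!]$, where $[\![\rho,\gamma]\!]=[\![\rho,\sigma_1]\!]\cap([\![\rho,\sigma_2]\!]\cup[\![\rho,\sigma_3]\!])$; and that $\mu$ satisfies (Mes) if $\mu(\{\sigma:\sigma_1<\sigma<\sigma_2\})>0$ whenever $\sigma_1<\sigma_2$. Every structured tree satisfying (Or1), (Or2), (Mes) is equivalent to the tree coded by a unique $h\in\mathcal{H}$ satisfying (Min). Almost surely, $\leq_{\mathrm{Sh}}$ satisfies (Or1), (Or2) and every finite Borel measure with support $T$ satisfies (Mes) with respect to $\leq_{\mathrm{Sh}}$; so $h_{\mathrm{Sh}}$ is a.s. well defined for all such $\mu$ simultaneously. *)

(* Defs.v *)
From HB Require Import structures.
From mathcomp Require Import all_boot all_order all_algebra finmap.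
From mathcomp Require Import generic_quotient lra.
From mathcomp Require Import all_classical all_reals all_analysis.

Set Implicit Arguments.
Unset Strict Implicit.
Unset Printing Implicit Defensive.

Import Order.TTheory GRing.Theory Num.Theory.
Import numFieldNormedType.Exports.

Local Open Scope quotient_scope.
Local Open Scope card_scope.
Local Open Scope classical_set_scope.
Local Open Scope ring_scope.

Section real_trees.
Context {R : realType} {T : metricType R}.
Implicit Types (x y z rho s : T).

Definition geodesic x y (g : R -> T) :=
  [/\ g 0 = x, g (mdist x y) = y &
      forall s t : R, s \in `[0, mdist x y] -> t \in `[0, mdist x y] ->
        mdist (g s) (g t) = `|s - t| ].

(* The union of the images of all geodesics from x to y; in a real tree these
   images all coincide, by the second clause of [real_tree]. *)
Definition segment x y : set T :=
  \bigcup_(g in geodesic x y) (g @` `[0, mdist x y]).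

Definition real_tree :=
  (forall x y, exists g, geodesic x y g) /\
  (forall q : R -> T,
     {within `[0, 1], continuous q} -> set_inj `[0, 1] q ->
     q @` `[0, 1] = segment (q 0) (q 1)).

(* In a real tree exactly one point satisfies the defining property; [rho] is
   only a default value. *)
Definition meet_pt rho x y : T :=
  xget rho [set z | segment rho z = segment rho x `&` segment rho y].

Definition components s : set (set T) :=
  connected_component (~` [set s]) @` (~` [set s]).

Definition leaves rho : set T :=
  [set s | s <> rho /\ components s #= `I_1].

Definition branch_points rho : set T :=
  [set s | s <> rho /\ `I_3 #<= components s].

Definition subtrees rho s : set (set T) :=
  [set A | components s A /\ ~ A rho].

Definition subtree_labelling rho (I : T -> set nat) (C : T -> nat -> set T) :=
  forall s,
    ((exists n, I s = [set k | (1 <= k <= n)%N]) \/ I s = [set k | (1 <= k)%N])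
    /\ set_bij (I s) (subtrees rho s) (C s).

Definition shuffle_index rho (I : T -> set nat) : set (T * nat) :=
  [set i | (branch_points rho i.1 \/ i.1 = rho) /\ I i.1 i.2].

Definition shuffle_le rho (I : T -> set nat) (C : T -> nat -> set T)
    (u : T * nat -> R) x y : Prop :=
  let m := meet_pt rho x y in
  x = y \/
  x <> y /\
  ((m = x \/ m = y) /\ segment rho y x \/
   ~ (m = x \/ m = y) /\
   exists k k', [/\ I m k, I m k', k <> k', C m k x /\ C m k' y &
                    u (m, k) <= u (m, k')]).

(* T, equipped with its Borel sigma-algebra; the point [rho] only serves as the
   canonical inhabitant that measurable types must have. *)
Definition borel (rho : T) : Type := T.

End real_trees.

Arguments real_tree {R} T.

Section borel_instances.
Context {R : realType} {T : metricType R} (rho : T).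

HB.instance Definition _ := Choice.on (borel rho).
HB.instance Definition _ := isPointed.Build (borel rho) rho.

Definition borel_opens : set (set (borel rho)) := @open T.

HB.instance Definition _ := @isMeasurable.Build (sigma_display borel_opens)
  (borel rho) <<s borel_opens >> (@sigma_algebra0 _ setT borel_opens)
  (@sigma_algebraC _ borel_opens) (@sigma_algebra_bigcup _ setT borel_opens).

Definition topological_support (mu : set T -> \bar R) : set T :=
  [set x | forall V : set T, open V -> V x -> (0 < mu V)%E].

End borel_instances.

(* The axioms of an order, of a measure and of a compact real tree are not
   bundled: a shuffled order is linear only almost surely. *)
Record structured_space (R : realType) := StructuredSpace {
  carrier :> metricType R;
  tree_root : carrier;
  tree_order : carrier -> carrier -> Prop;
  tree_mass : set carrier -> \bar R }.

Definition equivalent (R : realType) (X Y : structured_space R) :=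
  exists f : X -> Y,
    [/\ forall x y, mdist (f x) (f y) = mdist x y,
        set_surj setT setT f,
        f (tree_root X) = tree_root Y,
        forall x y, tree_order x y -> tree_order (f x) (f y) &
        forall A : set Y, measurable (A : set (borel (tree_root Y))) ->
          tree_mass A = tree_mass (f @^-1` A)].

(* Values outside [0, zeta] are irrelevant. *)
Record height_function (R : realType) := HeightFunction {
  zeta : R;
  height :> R -> R;
  zeta_ge0 : 0 <= zeta;
  height_ge0 : forall t, 0 <= t <= zeta -> 0 <= height t;
  height_left_cont : forall t, 0 < t <= zeta -> height @ t^'- --> height t;
  height_right_lim : forall t, 0 <= t < zeta -> cvg (height @ t^'+);
  height0 : height 0 = 0;
  height0_right : 0 < zeta -> height @ 0^'+ --> (0 : R);
  height_jump : forall t, 0 <= t < zeta ->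
    0 <= height t - lim (height @ t^'+) }.

Section coding.
Context {R : realType} (h : height_function R).

Definition height_dist (s t : R) : R :=
  h s + h t - 2 * inf [set h r | r in `[Num.min s t, Num.max s t]].

Definition times := {t : R | 0 <= t <= zeta h}.

Definition height_eq (s t : times) : bool :=
  height_dist (val s) (val t) == 0.

Lemma height_interval_ge0 (s t : times) r :
  r \in `[Num.min (val s) (val t), Num.max (val s) (val t)] -> 0 <= h r.
Proof.
case: s t => s /andP[s0 s1] [t /andP[t0 t1]] /=.
rewrite in_itv/= ge_min le_max => /andP[/orP a /orP b].
apply: height_ge0; apply/andP; split.
  by case: a; apply: le_trans.
by case: b => /le_trans; apply.
Qed.

Lemma height_interval_lbound (s t : times) : lbound [set h r | r in
  `[Num.min (val s) (val t), Num.max (val s) (val t)]] 0.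
Proof. by move=> _ [r rst <-]; exact: height_interval_ge0 rst. Qed.

Lemma height_interval_neq0 (s t : R) :
  [set h r | r in `[Num.min s t, Num.max s t]] !=set0.
Proof. by exists (h s), s => //=; rewrite in_itv/= ge_min le_max !lexx. Qed.

Lemma height_dist_refl s : height_dist s s = 0.
Proof.
by rewrite /height_dist minxx maxxx set_itv1 image_set1 inf1 mulr_natl subrr.
Qed.

Lemma height_dist_sym s t : height_dist s t = height_dist t s.
Proof. by rewrite /height_dist minC maxC (addrC (h s)). Qed.

Lemma height_dist_triangle (t s u : times) :
  height_dist (val s) (val u) <=
  height_dist (val s) (val t) + height_dist (val t) (val u).
Proof.
rewrite /height_dist.
set m := inf _; set a := inf _; set b := inf _.
have at_ : a <= h (val t).
  apply: ge_inf; first by exists 0; exact: height_interval_lbound.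
  by exists (val t) => //=; rewrite in_itv/= ge_min le_max !lexx !orbT.
have bt : b <= h (val t).
  apply: ge_inf; first by exists 0; exact: height_interval_lbound.
  by exists (val t) => //=; rewrite in_itv/= ge_min le_max !lexx.
have mab : Num.min a b <= m.
  apply: lb_le_inf; first exact: height_interval_neq0.
  move=> _ [r /= rsu <-]; rewrite ge_min.
  suff [rst|rtu] : (r \in `[Num.min (val s) (val t), Num.max (val s) (val t)])
    \/ (r \in `[Num.min (val t) (val u), Num.max (val t) (val u)]).
  - apply/orP; left; apply: ge_inf; last by exists r.
    by exists 0; exact: height_interval_lbound.
  - apply/orP; right; apply: ge_inf; last by exists r.
    by exists 0; exact: height_interval_lbound.
  move: rsu; rewrite !in_itv/= !ge_min !le_max => /andP[/orP sur /orP rsu].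
  have [rt|tr] := leP r (val t).
  - by case: sur => ->; rewrite ?orbT/=; [left|right].
  - by rewrite (ltW tr); case: rsu => ->; rewrite ?orbT/=; [left|right].
have [ab|/ltW ba] := leP a b.
  by move: mab; rewrite (min_idPl ab) => am; lra.
by move: mab; rewrite (min_idPr ba) => bm; lra.
Qed.

Lemma height_dist_ge0 (s t : times) : 0 <= height_dist (val s) (val t).
Proof.
have := height_dist_triangle t s s.
by rewrite height_dist_refl (height_dist_sym (val t)); lra.
Qed.

Lemma height_eq_refl : reflexive height_eq.
Proof. by move=> s; rewrite /height_eq height_dist_refl. Qed.

Lemma height_eq_sym : symmetric height_eq.
Proof. by move=> s t; rewrite /height_eq height_dist_sym. Qed.

Lemma height_eq_trans : transitive height_eq.
Proof.
move=> t s u /eqP st /eqP tu; rewrite /height_eq eq_le height_dist_ge0 andbT.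
by have := height_dist_triangle t s u; rewrite st tu addr0.
Qed.

Definition height_equiv : equiv_rel times :=
  EquivRel height_eq height_eq_refl height_eq_sym height_eq_trans.

Definition coded_tree := {eq_quot height_equiv}.

HB.instance Definition _ := Choice.on coded_tree.
HB.instance Definition _ := EqQuotient.on coded_tree.

Definition coded_proj (t : times) : coded_tree := \pi_coded_tree t.

Definition coded_dist (x y : coded_tree) : R :=
  height_dist (val (repr x)) (val (repr y)).

Lemma height_dist_repr t : height_dist (val (repr (coded_proj t))) (val t) = 0.
Proof. by apply/eqP; have /eqquotP := reprK (coded_proj t). Qed.

Lemma coded_dist_projE s t :
  coded_dist (coded_proj s) (coded_proj t) = height_dist (val s) (val t).
Proof.
have a0 := height_dist_repr s; have b0 := height_dist_repr t.
have a0' := a0; rewrite height_dist_sym in a0'.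
have b0' := b0; rewrite height_dist_sym in b0'.
have := height_dist_triangle s (repr (coded_proj s)) (repr (coded_proj t)).
have := height_dist_triangle t s (repr (coded_proj t)).
have := height_dist_triangle (repr (coded_proj s)) s t.
have := height_dist_triangle (repr (coded_proj t)) (repr (coded_proj s)) t.
by rewrite /coded_dist a0 b0 a0' b0'; lra.
Qed.

Lemma coded_distxx x : coded_dist x x = 0.
Proof. exact: height_dist_refl. Qed.

Lemma coded_dist_pos x y : coded_dist x y = 0 -> x = y.
Proof.
by move=> /eqP xy; rewrite -[x]reprK -[y]reprK; apply/eqquotP.
Qed.

Lemma coded_dist_sym x y : coded_dist x y = coded_dist y x.
Proof. exact: height_dist_sym. Qed.

Lemma coded_dist_triangle y x z :
  coded_dist x z <= coded_dist x y + coded_dist y z.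
Proof. exact: height_dist_triangle. Qed.

HB.instance Definition _ := @isMetric.Build R coded_tree coded_dist
  coded_distxx coded_dist_pos coded_dist_sym coded_dist_triangle.

Lemma times0 : 0 <= (0 : R) <= zeta h.
Proof. by rewrite lexx zeta_ge0. Qed.

Definition coded_root : coded_tree := coded_proj (exist _ 0 times0).

(* p_h^-1(A), as a subset of the real line *)
Definition coded_proj_preimage (A : set coded_tree) : set R :=
  val @` (coded_proj @^-1` A).

Definition first_time (x : coded_tree) : R := inf (coded_proj_preimage [set x]).

Definition coded_le (x y : coded_tree) : Prop := first_time x <= first_time y.

Definition coded_mass (A : set coded_tree) : \bar R :=
  lebesgue_measure (coded_proj_preimage A).

Definition coded_space : structured_space R :=
  @StructuredSpace R coded_tree coded_root coded_le coded_mass.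

(* [inf set0] is 0 in the library, hence the case distinction. *)
Definition last_time (x : coded_tree) : R :=
  let E := coded_proj_preimage (~` [set x]) `&` [set t | first_time x < t] in
  if E == set0 then zeta h else inf E.

(* (Min). On non-Borel sets, [lebesgue_measure] is the Lebesgue outer measure,
   so this says that the complement is Lebesgue-negligible. *)
Definition minimal_height : Prop :=
  lebesgue_measure (`[0, zeta h] `\`
    \bigcup_(x : coded_tree) `[first_time x, last_time x]%classic) = 0%E.

End coding.

(* A relation rather than a function: that a structured tree satisfying (Or1),
   (Or2) and (Mes) has such an [h], unique on [0, zeta h], is a theorem. *)
Definition height_function_of (R : realType) (X : structured_space R)
    (h : height_function R) : Prop :=
  minimal_height h /\ equivalent (coded_space h) X.

Definition mutually_independent d (Omega : measurableType d) (R : realType)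
    (P : probability Omega R) (K : choiceType) (J : set K)
    (X : K -> {RV P >-> R}) : Prop :=
  forall (F : {fset K}) (A : K -> set R), [set` F] `<=` J ->
    (forall i, measurable (A i)) ->
    P (\bigcap_(i in [set` F]) (X i @^-1` A i)) =
    (\prod_(i <- F) P (X i @^-1` A i))%E.

Definition iid_uniform d (Omega : measurableType d) (R : realType)
    (P : probability Omega R) (K : choiceType) (J : set K)
    (X : K -> {RV P >-> R}) : Prop :=
  mutually_independent J X /\
  forall i, J i -> forall A : set R, measurable A ->
    distribution P (X i) A = uniform_prob (@ltr01 R) A.

(* Main.v *)
Require Import Defs.
From mathcomp Require Import all_boot all_order all_algebra finmap ring lra.
From mathcomp Require Import all_classical all_reals all_analysis.
Import Order.TTheory GRing.Theory Num.Theory.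
Import numFieldNormedType.Exports.
Local Open Scope classical_set_scope.
Local Open Scope ring_scope.

(** Write H for the distance to the root rho. A height function is
    left-continuous, so a discontinuity is a time t at which h drops from h(t)
    to a smaller right limit g. Let sigma be the point of the tree visited at
    time t; then H(sigma) = h(t). A point y whose first visit comes after the
    first visit of sigma is either visited before t, and is then a descendant
    of sigma, or visited after t, and is then joined to sigma by a path going
    down to height g at least ([jump_separates]). So no subtree grafted on the
    ancestral line of sigma strictly between the heights g and H(sigma) comes
    after sigma in the order of the coded tree: at each branch point of that
    stretch of the line, the subtree containing sigma is the last one.

    There are infinitely many such branch points, because the leaves are dense
    ([exists_branch]: a leaf close to the middle of a piece of a segment cannot
    lie on the segment, hence branches off it nearby). By independence of the
    shuffles at different points, it is almost sure that the subtree containing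
    sigma is beaten at one of them ([ae_split_event]). The stretch of line is
    random, but it contains a stretch chosen from a countable family: the points
    with height in ]q, r[ on the segment from rho to x, for rational q < r and x
    in a fixed countable dense set. Indeed, if x is close enough to sigma, then
    sigma and x lie in the same component of the complement of every such point
    ([fork_not_le]). Hence one null set takes care of all measures mu and of all
    height functions h at once.

    The geometry rests on one fact, [separation]: two points lie in the same
    component of the complement of b iff b is not on the segment between them.
    It comes from [median], where the uniqueness of arcs is applied to a
    concatenation of two geodesics. *)

Set Implicit Arguments.
Unset Strict Implicit.
Unset Printing Implicit Defensive.

(** * Betweenness and geodesics in a real tree *)

Section real_tree_geometry.
Context {R : realType} {T : metricType R}.
Implicit Types (b c p x y z rho : T) (s t L : R) (q g : R -> T).

Definition btw x z y : Prop := mdist x z + mdist z y = mdist x y.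

Lemma btwE x z y : mdist x z + mdist z y <= mdist x y -> btw x z y.
Proof. by move=> h; apply/le_anti; rewrite h metric_triangle. Qed.

Lemma btw_sym {x z y} : btw x z y -> btw y z x.
Proof.
by rewrite /btw addrC (metric_sym z) (metric_sym x z) (metric_sym x y).
Qed.

Lemma btw_l x y : btw x x y.
Proof. by rewrite /btw mdistxx add0r. Qed.

Lemma btw_r x y : btw x y y.
Proof. by rewrite /btw mdistxx addr0. Qed.

Lemma btw_xx x z : btw x z x -> z = x.
Proof.
rewrite /btw mdistxx (metric_sym x z) => h; apply: mdist_positivity.
by have := mdist_ge0 z x; lra.
Qed.

Lemma btw_trans {x c y z} : btw x c y -> btw x z c -> btw x z y.
Proof.
move=> xcy xzc; apply: btwE; move: xcy xzc; rewrite /btw.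
by have := metric_triangle z c y; lra.
Qed.

Definition nonexpansive_on L (q : R -> T) := forall s t,
  0 <= s <= L -> 0 <= t <= L -> s <= t -> mdist (q s) (q t) <= t - s.

Lemma lipschitz_continuous (k : R) L q : 0 < k ->
  (forall s t, 0 <= s <= L -> 0 <= t <= L -> s <= t ->
     mdist (q s) (q t) <= k * (t - s)) ->
  {within `[0, L], continuous q}.
Proof.
move=> k0 qL; apply/subspace_continuousP => s; rewrite /= in_itv/= => sL.
apply/metricType_numDomainType.cvgrPdist_lt => e e0; near=> t.
have tL : 0 <= t <= L.
  by have : t \in `[0, L] by near: t; exact: withinT; rewrite in_itv.
have ste : `|s - t| < e / k.
  near: t; apply: cvg_within.
  by apply: (@cvgr_dist_lt _ _ _ (nbhs s)) => //; exact: divr_gt0.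
have {}ste : k * `|s - t| < e by rewrite mulrC -ltr_pdivlMr.
have [st|/ltW ts] := leP s t.
- apply: le_lt_trans (qL _ _ sL tL st) _.
  by rewrite distrC ger0_norm ?subr_ge0 in ste.
- rewrite metric_sym; apply: le_lt_trans (qL _ _ tL sL ts) _.
  by rewrite ger0_norm ?subr_ge0 in ste.
Unshelve. all: by end_near. Qed.

(** A form of the definition of a geodesic that linear arithmetic can use. *)
Lemma geodesicP x y g : geodesic x y g <->
  [/\ g 0 = x, g (mdist x y) = y & forall s t, 0 <= s <= mdist x y ->
     0 <= t <= mdist x y -> s <= t -> mdist (g s) (g t) = t - s].
Proof.
split=> -[g0 g1 gd]; split=> //.
- by move=> s t sL tL st; rewrite gd ?in_itv// distrC ger0_norm ?subr_ge0.
- move=> s t; rewrite !in_itv/= => sL tL.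
  have [st|/ltW ts] := leP s t.
  + by rewrite gd// distrC ger0_norm ?subr_ge0.
  + by rewrite metric_sym gd// ger0_norm ?subr_ge0.
Qed.

Lemma geodesic_nonexpansive {x y g} :
  geodesic x y g -> nonexpansive_on (mdist x y) g.
Proof. by move=> /geodesicP[_ _ gd] s t sL tL st; rewrite gd. Qed.

Definition splice L (g1 g2 : R -> T) s := if s <= L then g1 s else g2 (s - L).

Lemma splice_nonexpansive L1 L2 (g1 g2 : R -> T) : 0 <= L1 -> 0 <= L2 ->
  nonexpansive_on L1 g1 -> nonexpansive_on L2 g2 -> g1 L1 = g2 0 ->
  nonexpansive_on (L1 + L2) (splice L1 g1 g2).
Proof.
move=> L10 L20 n1 n2 g12 s t sL tL st; rewrite /splice.
case: ifPn => [s1|]; case: ifPn => [t1|].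
- by apply: n1 => //; lra.
- rewrite -ltNge => t1; apply: le_trans (metric_triangle _ (g1 L1) _) _.
  have : mdist (g1 s) (g1 L1) <= L1 - s by apply: n1; lra.
  have : mdist (g2 0) (g2 (t - L1)) <= (t - L1) - 0 by apply: n2; lra.
  by rewrite g12; lra.
- by rewrite -ltNge; lra.
- rewrite -!ltNge => t1 s1.
  have : mdist (g2 (s - L1)) (g2 (t - L1)) <= (t - L1) - (s - L1).
    by apply: n2; lra.
  lra.
Qed.

Lemma btw_geodesic x z y g1 g2 : btw x z y ->
  geodesic x z g1 -> geodesic z y g2 -> geodesic x y (splice (mdist x z) g1 g2).
Proof.
move=> xzy G1 G2.
have [/geodesicP[g10 g11 gd1] /geodesicP[g20 g21 gd2]] := (G1, G2).
have [xz0 zy0] := (mdist_ge0 x z, mdist_ge0 z y).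
have L12 : mdist x z + mdist z y = mdist x y by [].
have q0 : splice (mdist x z) g1 g2 0 = x by rewrite /splice xz0.
have q1 : splice (mdist x z) g1 g2 (mdist x y) = y.
  rewrite /splice; case: ifPn => [yz|_].
  - have zy : z = y by apply: mdist_positivity; lra.
    by rewrite -{1}zy g11.
  - by rewrite -L12 addrAC subrr add0r.
have qn : nonexpansive_on (mdist x y) (splice (mdist x z) g1 g2).
  rewrite -L12; apply: splice_nonexpansive => //.
  + exact: geodesic_nonexpansive.
  + exact: geodesic_nonexpansive.
  + by rewrite g11 g20.
apply/geodesicP; split=> // s t sL tL st; apply/le_anti; rewrite qn//=.
have := metric_triangle x (splice (mdist x z) g1 g2 s) y.
have := metric_triangle (splice (mdist x z) g1 g2 s)
  (splice (mdist x z) g1 g2 t) y.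
have h1 := qn 0 s; have h2 := qn t (mdist x y); rewrite q0 in h1.
rewrite q1 in h2.
have : mdist x (splice (mdist x z) g1 g2 s) <= s - 0 by apply: h1; lra.
have : mdist (splice (mdist x z) g1 g2 t) y <= mdist x y - t by apply: h2; lra.
lra.
Qed.

Hypothesis tree : real_tree T.

(** The uniqueness of arcs, for arcs parametrized by an interval of any
    length. *)
Lemma arc_image L q : 0 < L -> nonexpansive_on L q ->
  (forall s t, 0 <= s <= L -> 0 <= t <= L -> q s = q t -> s = t) ->
  q @` `[0, L] = segment (q 0) (q L).
Proof.
move=> L0 qL qi.
have sc u : u \in `[0, 1] -> 0 <= u * L <= L.
  rewrite in_itv/= => /andP[u0 u1]; rewrite mulr_ge0 ?(ltW L0)//=.
  by rewrite ler_piMl ?(ltW L0).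
have := tree.2 (fun u => q (u * L)); rewrite mul0r mul1r => <-.
- apply/seteqP; split=> _ [s /= sL <-].
  + exists (s / L); last by rewrite divfK// gt_eqF.
    move: sL; rewrite /= !in_itv/= => /andP[s0 sL].
    by rewrite divr_ge0 ?(ltW L0)//= ler_pdivrMr// mul1r.
  + by exists (s * L) => //=; rewrite in_itv/=; exact: sc.
- apply: (@lipschitz_continuous L) => // s t s1 t1 st.
  rewrite (mulrC L) mulrBl; apply: qL; rewrite ?ler_wpM2r ?(ltW L0)//;
    by apply: sc; rewrite in_itv.
- move=> s t; rewrite !inE => s1 t1 /(qi _ _ (sc _ s1) (sc _ t1)).
  by apply: mulIf; rewrite gt_eqF.
Qed.

Lemma geodesic_injective x y g s t : geodesic x y g ->
  0 <= s <= mdist x y -> 0 <= t <= mdist x y -> g s = g t -> s = t.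
Proof.
move=> [_ _ gd] sL tL /(congr1 (mdist (g s))).
by rewrite mdistxx gd ?in_itv// => /esym/normr0_eq0/subr0_eq.
Qed.

(** Uniqueness of geodesics: the geodesic through [z] obtained by splicing has
    the same image as [g], and a point of a geodesic is determined by its
    distance to the starting point. *)
Lemma geodesic_at x y g z : geodesic x y g -> btw x z y -> g (mdist x z) = z.
Proof.
move=> G xzy; have [g0 g1 gd] := G.
have [xz0 zy0] := (mdist_ge0 x z, mdist_ge0 z y).
have [g' G1] := tree.1 x z; have [g'' G2] := tree.1 z y.
have := btw_geodesic xzy G1 G2; set g3 := splice _ _ _ => G3.
have [xy0|xy0] := leP (mdist x y) 0.
  have zx : mdist x z = 0 by move: xzy; rewrite /btw; lra.
  by rewrite zx g0; exact: mdist_positivity.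
have im := arc_image xy0 (geodesic_nonexpansive G)
  (fun s t => geodesic_injective G (s:=s) (t:=t)).
have im3 := arc_image xy0 (geodesic_nonexpansive G3)
  (fun s t => geodesic_injective G3 (s:=s) (t:=t)).
have [g30 g31 _] := G3.
rewrite g30 g31 in im3; rewrite g0 g1 -im3 in im.
have xzL : mdist x z \in `[0, mdist x y].
  by rewrite in_itv/= xz0 -(xzy : _ = _) lerDl.
have : (g @` `[0, mdist x y]) z.
  rewrite im; exists (mdist x z) => //.
  by have [_ + _] := G1; rewrite /g3 /splice lexx.
move=> [s sL gs]; rewrite -gs; congr g.
have : mdist (g 0) (g s) = `|0 - s| by apply: gd; rewrite // in_itv/= lexx ltW.
rewrite g0 gs sub0r normrN ger0_norm ?gs//.
by move: sL; rewrite /= in_itv/= => /andP[].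
Qed.

Lemma geodesic_btw x y g s : geodesic x y g -> 0 <= s <= mdist x y ->
  mdist x (g s) = s /\ mdist (g s) y = mdist x y - s.
Proof.
move=> /geodesicP[g0 g1 gd] sL.
rewrite -{1}g0 gd ?subr0//; try lra.
by split=> //; rewrite -{1}g1 gd//; lra.
Qed.

Lemma segmentE x y : segment x y = [set z | btw x z y].
Proof.
apply/seteqP; split=> z /=.
- move=> [g G [s]]; rewrite /= in_itv/= => sL <-.
  by have [e1 e2] := geodesic_btw G sL; rewrite /btw e1 e2; lra.
- move=> xzy; have [g G] := tree.1 x y; exists g => //.
  exists (mdist x z); last exact: (geodesic_at G).
  by rewrite /= in_itv/= mdist_ge0 -(xzy : _ = _) lerDl mdist_ge0.
Qed.

(** Let [c] be the last point of the segment from [q] to [p] that lies on the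
    segment from [q] to [r]. Going from [p] to [c] and on from [c] to [r] never
    visits a point twice, so this path runs along the segment from [p] to [r],
    which therefore contains [c]. *)
Lemma median (p q r : T) : exists c, [/\ btw p c q, btw q c r & btw p c r].
Proof.
have [g G] := tree.1 q p; have [g0 g1 _] := G.
have L0 := mdist_ge0 q p.
pose S := [set s | 0 <= s <= mdist q p /\ btw q (g s) r].
have S0 : S 0 by split; [rewrite lexx | rewrite g0; exact: btw_l].
have supS : has_sup S.
  by split; [exists 0 | exists (mdist q p) => s [/andP[_ sL] _]].
pose a := sup S.
have a0 : 0 <= a by apply: ub_le_sup => //; case: supS.
have aL : a <= mdist q p.
  by apply: ge_sup; [exists 0 | move=> s [/andP[_ sL] _]].
have aaL : 0 <= a <= mdist q p by rewrite a0.
have gn := geodesic_nonexpansive G.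
(* The supremum is attained, by continuity of the distance to r. *)
have Sa : btw q (g a) r.
  apply: btwE; have [-> _] := geodesic_btw G aaL.
  apply/ler_addgt0Pr => e e0.
  have [s [sL sb] as_] := sup_adherent (divr_gt0 e0 (ltr0n _ 2)) supS.
  have sa : s <= a by apply: ub_le_sup => //; case: supS.
  have := gn s a sL aaL sa; have := metric_triangle (g a) (g s) r.
  rewrite (metric_sym (g a) (g s)); move: sb; rewrite /btw.
  have [-> _] := geodesic_btw G sL; rewrite -/a in as_; lra.
have ub s : 0 <= s <= mdist q p -> btw q (g s) r -> s <= a.
  by move=> sL sb; apply: ub_le_sup; [case: supS | split].
exists (g a).
have qcp : btw q (g a) p.
  by have [e1 e2] := geodesic_btw G aaL; rewrite /btw e1 e2; lra.
split=> //; first exact: btw_sym.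
have [k K] := tree.1 (g a) r; have [k0 k1 _] := K.
have cr0 := mdist_ge0 (g a) r.
have [LL|LL] := leP (mdist q p - a + mdist (g a) r) 0.
  have <- : g a = r by apply: mdist_positivity; lra.
  exact: btw_r.
(* g' runs along g backwards, from p to c. *)
pose g' s := g (mdist q p - s).
have g'n : nonexpansive_on (mdist q p - a) g'.
  move=> s t sL tL st; rewrite /g' metric_sym.
  have : mdist (g (mdist q p - t)) (g (mdist q p - s)) <=
    mdist q p - s - (mdist q p - t) by apply: gn; lra.
  lra.
have La : 0 <= mdist q p - a by lra.
pose h := splice (mdist q p - a) g' k.
have hn : nonexpansive_on (mdist q p - a + mdist (g a) r) h.
  apply: splice_nonexpansive => //; first exact: geodesic_nonexpansive.
  by rewrite k0 /g'; congr g; lra.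
have cross s t : 0 <= s <= mdist q p - a -> 0 < t <= mdist (g a) r ->
    g' s <> k t.
  move=> sL tL st.
  have tL' : 0 <= t <= mdist (g a) r by lra.
  have [e1 e2] := geodesic_btw K tL'.
  have qk : btw q (k t) r.
    apply: btw_sym; apply: btw_trans (btw_sym Sa) _; apply: btw_sym.
    by rewrite /btw e1 e2; lra.
  have := ub (mdist q p - s); rewrite -/(g' s) st => /(_ _ qk) sa.
  have {}sa : mdist q p - s <= a by apply: sa; lra.
  have sE : mdist q p - s = a by lra.
  by move: e1; rewrite -st /g' sE mdistxx; lra.
have hi s t : 0 <= s <= mdist q p - a + mdist (g a) r ->
    0 <= t <= mdist q p - a + mdist (g a) r -> h s = h t -> s = t.
  rewrite /h /splice => sL tL; case: ifPn => s1; case: ifPn => t1.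
  - move=> /(geodesic_injective G) st.
    suff : mdist q p - s = mdist q p - t by lra.
    by apply: st; lra.
  - by move=> /cross; case; move: t1; rewrite -ltNge; lra.
  - by move=> /esym/cross; case; move: s1; rewrite -ltNge; lra.
  - move: s1 t1; rewrite -!ltNge => s1 t1 /(geodesic_injective K) st.
    suff : s - (mdist q p - a) = t - (mdist q p - a) by lra.
    by apply: st; lra.
have := arc_image LL hn hi.
have -> : h 0 = p by rewrite /h /splice La /g' subr0.
have -> : h (mdist q p - a + mdist (g a) r) = r.
  rewrite /h /splice; case: ifPn => [h1|_].
    have cr : mdist (g a) r = 0 by lra.
    by rewrite cr addr0 /g' subKr; exact: mdist_positivity.
  by rewrite addrAC subrr add0r.
rewrite segmentE => im.
have : [set z | btw p z r] (g a).
  rewrite -im; exists (mdist q p - a).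
    by rewrite /= in_itv/=; lra.
  by rewrite /h /splice lexx /g' subKr.
by [].
Qed.

(** Triangles are tripods: the median of [p], [q], [r] splits the segment from
    [p] to [r] into a part on the way to [q] and a part coming from [q]. *)
Lemma btw_split p b (r : T) : btw p b r -> forall q : T, btw p b q \/ btw q b r.
Proof.
move=> pbr q; have [c [pcq qcr pcr]] := median p q r.
have [g G] := tree.1 p r; have /geodesicP[g0 g1 gd] := G.
have gb := geodesic_at G pbr; have gc := geodesic_at G pcr.
have L1 : mdist p b + mdist b r = mdist p r by [].
have L2 : mdist p c + mdist c r = mdist p r by [].
have := (mdist_ge0 p b, mdist_ge0 b r, mdist_ge0 p c, mdist_ge0 c r).
move=> [[[n1 n2] n3] n4].
have [bc|/ltW cb] := leP (mdist p b) (mdist p c); [left|right].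
- apply: (btw_trans pcq); rewrite /btw.
  have : mdist (g (mdist p b)) (g (mdist p c)) = mdist p c - mdist p b.
    by apply: gd; lra.
  by rewrite gb gc; lra.
- apply: btw_sym; apply: btw_trans (btw_sym qcr) _; apply: btw_sym.
  have : mdist (g (mdist p c)) (g (mdist p b)) = mdist p b - mdist p c.
    by apply: gd; lra.
  by rewrite gb gc /btw; lra.
Qed.

(** * Components of the complement of a point *)

(** By [btw_split], whether [b] is between [p] and [z] does not change when [z]
    moves in a ball that avoids [b]; so the points [z] for which it is form an
    open and closed subset of the complement of [b], and a connected set
    avoiding [b] lies on one side of it. Conversely, a segment avoiding [b] is
    connected. *)
Lemma separation b p (q : T) : p <> b -> q <> b ->
  connected_component (~` [set b]) p q <-> ~ btw p b q.
Proof.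
move=> pb qb; split.
- move=> [K [Kp Kb Kc] Kq] pbq.
  have ball_sub z z' : mdist z z' < mdist z b -> ~ btw z b z'.
    by rewrite /btw; have := mdist_ge0 b z'; lra.
  have same z z' : mdist z z' < mdist z b -> btw p b z <-> btw p b z'.
    move=> zz'; split.
    + by move=> /btw_split/(_ z')[//|/btw_sym/(ball_sub _ _ zz')].
    + by move=> /btw_split/(_ z)[//|/(ball_sub _ _ zz')].
  have ballo z : z <> b ->
      nbhs z [set z' | z' <> b /\ (btw p b z <-> btw p b z')].
    move=> zb; have : 0 < mdist z b by rewrite mdist_gt0; exact/eqP.
    move=> zb0; rewrite -nbhs_ballE; exists (mdist z b) => //.
    move=> z'; rewrite ballEmdist/= => zz'; split; last exact: same.
    by move=> z'b; move: zz'; rewrite z'b ltxx.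
  pose V := [set z | ~ btw p b z].
  have KV : K `&` V = K.
    apply: Kc; first by exists p; split=> // /btw_xx/esym/pb.
    + exists V => //; rewrite openE => z Vz.
      have zb : z <> b by move=> zb; apply: Vz; rewrite zb; exact: btw_r.
      by apply: filterS (ballo z zb) => z' /= -[_ zz'] /zz'.
    + exists (~` [set z | z <> b /\ btw p b z]); last first.
        apply/seteqP; split=> z [Kz Vz]; split=> //; first by case.
        by move=> pbz; apply: Vz; split=> //; exact: Kb.
      apply: open_closedC; rewrite openE => z [zb pbz].
      by apply: filterS (ballo z zb) => z' /= -[z'b zz']; split=> //; apply/zz'.
  by have [] : (K `&` V) q by rewrite KV.
- move=> npq; have [g G] := tree.1 p q; have [g0 g1 _] := G.
  exists (g @` `[0, mdist p q]); last first.
    by exists (mdist p q) => //=; rewrite in_itv/= lexx mdist_ge0.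
  split.
  + by exists 0 => //=; rewrite in_itv/= lexx mdist_ge0.
  + move=> z [s /=]; rewrite in_itv/= => sL <- gsb; apply: npq.
    by have [e1 e2] := geodesic_btw G sL; rewrite -gsb /btw e1 e2; lra.
  + have gc : {within `[0, mdist p q], continuous g}.
      apply: (@lipschitz_continuous 1) => // s u sL uL su.
      by rewrite mul1r; exact: (geodesic_nonexpansive G).
    by apply: connected_continuous_connected gc; exact: segment_connected.
Qed.

(** A leaf [l] close to the middle of the piece of segment at heights in ]s, t[
    branches off near the middle, at the median [b] of [rho], [x] and [l]. It
    does branch off: a point inside the segment separates [rho] from [x], so it
    is not a leaf. *)
Lemma exists_branch rho x s t : closure (leaves rho) = [set: T] ->
  0 <= s -> s < t -> t <= mdist rho x ->
  exists b l, [/\ s < mdist rho b < t, btw rho b x, btw rho b l,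
                  btw x b l & l <> b].
Proof.
move=> dense s0 st tx; have [g G] := tree.1 rho x.
set m := (s + t) / 2; set e := (t - s) / 4.
have e0 : 0 < e by rewrite divr_gt0// subr_gt0.
have mL : 0 <= m <= mdist rho x by rewrite /m; lra.
have [d1 d2] := geodesic_btw G mL.
have : closure (leaves rho) (g m) by rewrite dense.
move=> /(_ (ball (g m) e) (nbhsx_ballx _ _ e0)) [l [[lrho l1]]].
rewrite ballEmdist/= => gl.
have [b [bx xl rl]] := median rho x l.
have be : mdist b l <= e.
  move: bx xl rl; rewrite /btw (metric_sym x b).
  have := metric_triangle rho (g m) l; have := metric_triangle x (g m) l.
  by rewrite (metric_sym x (g m)); lra.
have sbt : s < mdist rho b < t.
  have := metric_triangle rho (g m) b; have := metric_triangle rho b (g m).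
  have := metric_triangle (g m) l b.
  rewrite (metric_sym l b) (metric_sym b (g m)).
  by rewrite /m /e in d1 d2 be gl *; lra.
exists b, l; split=> // lb; rewrite -{}lb in sbt bx.
have xl0 : x <> l by move=> xl0; move: sbt; rewrite -xl0; lra.
have [f f_bij] := card_set_bijP l1.
pose cc := connected_component (~` [set l]).
have one A B : components l A -> components l B -> A = B.
  move=> lA lB; apply: (set_bij_inj f_bij); rewrite ?inE//.
  have := set_bij_homo f_bij lA; have := set_bij_homo f_bij lB.
  by rewrite II1 /= => -> ->.
have E : cc rho = cc x.
  by apply: one; [exists rho => //; exact: nesym | exists x].
have : cc rho x.
  by rewrite E; exact: connected_component_refl.
by move/separation; apply=> //; exact: nesym.
Qed.

Lemma branch_pointI rho x y b : rho <> b -> x <> b -> y <> b ->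
  btw rho b x -> btw rho b y -> btw x b y -> branch_points rho b.
Proof.
move=> rb xb yb rx ry xy; split; first by move=> /esym.
pose cc := connected_component (~` [set b]).
have ccP p (q : T) : p <> b -> q <> b -> btw p b q -> cc p <> cc q.
  move=> pb qb pq ccpq; have : cc q q by exact: connected_component_refl.
  by rewrite -ccpq => /separation; apply.
pose f n := if n == 0%N then cc rho else if n == 1%N then cc x else cc y.
have fi : {in `I_3 &, injective f}.
  have n1 := ccP _ _ rb xb rx; have n2 := ccP _ _ rb yb ry.
  have n3 := ccP _ _ xb yb xy.
  move=> [|[|[|i]]] [|[|[|j]]]; rewrite ?inE//= => _ _; rewrite /f/= => fE //;
    by [case: n1 | case: n2 | case: n3].
rewrite -(card_le_eql (inj_card_eq fi)); apply: subset_card_le.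
move=> _ [n _ <-]; rewrite /f; case: ifP => _; first by exists rho.
by case: ifP => _; [exists x | exists y].
Qed.

(** By [btw_split], any point [p] is separated by [b] from [x] or from [y]; if
    moreover [p] lies on the segments from [rho] to [x] and to [y], then it lies
    on the segment from [rho] to [b]. *)
Lemma meet_ptE rho x y b : btw rho b x -> btw rho b y -> btw x b y ->
  meet_pt rho x y = b.
Proof.
move=> rx ry xy.
have segI : segment rho b = segment rho x `&` segment rho y.
  rewrite !segmentE//; apply/seteqP; split=> p /=.
    by move=> rpb; split; [exact: (btw_trans rx) | exact: (btw_trans ry)].
  move=> [rpx rpy]; have [xbp|pby] := btw_split xy p; apply: btwE.
    move: rpx xbp rx.
    by rewrite /btw (metric_sym x b) (metric_sym x p) (metric_sym p b); lra.
  by move: rpy pby ry; rewrite /btw (metric_sym p b); lra.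
rewrite /meet_pt; case: xgetP => [z _|/(_ b)]; last by case.
rewrite /= -segI !segmentE// => zb.
have [] : [set p | btw rho p b] z /\ [set p | btw rho p z] b.
  by split; [rewrite -zb; exact: btw_r | rewrite zb; exact: btw_r].
rewrite /= /btw (metric_sym b z) => rzb rbz.
by apply: mdist_positivity; have := mdist_ge0 z b; lra.
Qed.

(** * Labelled subtrees and the shuffled order *)

Section labels.
Variables (rho : T) (I : T -> set nat) (C : T -> nat -> set T).
Hypothesis labels : subtree_labelling rho I C.

Lemma label_of_point b p : rho <> b -> p <> b -> btw rho b p ->
  exists2 k, I b k & C b k p.
Proof.
move=> rb pb rp; have [_ [_ _ onto]] := labels b.
have : subtrees rho b (connected_component (~` [set b]) p).
  split; first by exists p.
  by move/separation => /(_ pb rb); apply; exact: btw_sym.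
move=> /onto[k Ik CE].
by exists k => //; rewrite CE; exact: connected_component_refl.
Qed.

Lemma label_component b k p : I b k -> C b k p ->
  [/\ p <> b, C b k = connected_component (~` [set b]) p &
      rho <> b -> btw rho b p].
Proof.
move=> Ik Cp; have [_ [into _ _]] := labels b.
have [[z zb CE] nr] := into k Ik; rewrite -CE in Cp nr.
have pb : p <> b by exact: (connected_component_sub Cp).
split=> //; first by rewrite -CE; exact: same_connected_component.
move=> rb; apply: contrapT => /separation => /(_ rb pb) rp; apply: nr.
exact: connected_component_trans Cp (connected_component_sym rp).
Qed.

Lemma label_inj b k k' p : I b k -> I b k' -> C b k p -> C b k' p -> k = k'.
Proof.
move=> Ik Ik' Cp Cp'; have [_ [_ inj _]] := labels b.
have [_ E _] := label_component Ik Cp; have [_ E' _] := label_component Ik' Cp'.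
by apply: inj; rewrite ?inE// E E'.
Qed.

Lemma label_btw b k k' p p' : I b k -> I b k' -> k <> k' ->
  C b k p -> C b k' p' -> btw p b p'.
Proof.
move=> Ik Ik' kk' Cp Cp'; have [pb E _] := label_component Ik Cp.
have [pb' _ _] := label_component Ik' Cp'.
apply: contrapT => /separation => /(_ pb pb'); rewrite -E => C'.
by apply: kk'; exact: label_inj Cp'.
Qed.

Lemma shuffle_le_label (u : T * nat -> R) b k k' p p' : rho <> b ->
  I b k -> I b k' -> k <> k' -> C b k p -> C b k' p' ->
  shuffle_le rho I C u p p' -> u (b, k) <= u (b, k').
Proof.
move=> rb Ik Ik' kk' Cp Cp'; have pbp' := label_btw Ik Ik' kk' Cp Cp'.
have [pb _ /(_ rb) rp] := label_component Ik Cp.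
have [pb' _ /(_ rb) rp'] := label_component Ik' Cp'.
rewrite /shuffle_le (meet_ptE rp rp' pbp').
move=> [pp'|[_ [[[/esym/pb//|/esym/pb'//]]|]]].
  by case: kk'; apply: (label_inj Ik Ik' Cp); rewrite pp'.
move=> [_ [j [j' [Ij Ij' _ [Cj Cj'] u_le]]]].
by rewrite (label_inj Ik Ij Cp Cj) (label_inj Ik' Ij' Cp' Cj').
Qed.

End labels.
End real_tree_geometry.

(** * Independent uniform variables *)

Lemma uniform_prob_half (R : realType) :
  uniform_prob (@ltr01 R) [set` `]-oo, 2^-1]%R] = (2^-1)%:E.
Proof.
rewrite /uniform_prob integral_uniform_pdf.
have -> : [set` `]-oo, 2^-1]%R] `&` `[0, 1] = `[0, 2^-1 : R]%classic.
  apply/seteqP; split=> x; rewrite /= !in_itv/=; lra.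
rewrite (eq_integral (fun=> 1%:E)); last first.
  move=> x; rewrite inE/= in_itv/= /uniform_pdf subr0 invr1 => x2.
  by rewrite ifT//; lra.
rewrite integral_cst//= lebesgue_measure_itv/= lte_fin invr_gt0 ltr0n.
by rewrite mul1e oppr0 adde0.
Qed.

Section independent_uniform.
Context d (Omega : measurableType d) (R : realType) (P : probability Omega R)
  (K : choiceType) (J : set K) (X : K -> {RV P >-> R}).
Hypothesis iid : iid_uniform J X.

Local Notation low := ([set` `]-oo, 2^-1 : R]%R]).
Local Notation high := (~` low).

Definition cylinder (F : {fset K}) (A : K -> set R) : set Omega :=
  \bigcap_(i in [set` F]) (X i @^-1` A i).

Lemma measurable_cylinder F A :
  (forall i, measurable (A i)) -> measurable (cylinder F A).
Proof.
move=> mA; apply: fin_bigcap_measurable; first exact: finite_fset.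
by move=> i _; apply: measurable_funPTI.
Qed.

(** A way for [X i] to be smaller than [X j] whose probability, 1/4, is read off
    the values at 1/2 of the two distribution functions. *)
Definition split_event (i j : K) : set Omega :=
  X i @^-1` low `&` X j @^-1` high.

Lemma measurable_split_event i j : measurable (split_event i j).
Proof.
by apply: measurableI; apply: measurable_funPTI => //; exact: measurableC.
Qed.

Lemma prob_low i : J i -> P (X i @^-1` low) = (2^-1)%:E.
Proof. by move=> Ji; rewrite -uniform_prob_half -(iid.2 i Ji). Qed.

Lemma prob_high i : J i -> P (X i @^-1` high) = (2^-1)%:E.
Proof.
move=> Ji; rewrite preimage_setC probability_setC ?prob_low//.
  by rewrite -EFinB; congr EFin; lra.
exact: (measurable_funPTI (X i) (measurable_itv _)).
Qed.

Lemma cylinder_split_event F A i j : [set` F] `<=` J ->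
  (forall k, measurable (A k)) -> J i -> J j -> i != j ->
  i \notin F -> j \notin F -> exists B, [/\ forall k, measurable (B k),
    cylinder F A `&` split_event i j = cylinder (i |` (j |` F))%fset B &
    P (cylinder (i |` (j |` F))%fset B) = (P (cylinder F A) * (4^-1)%:E)%E].
Proof.
move=> FJ mA Ji Jj ij iF jF.
pose B k := if k == i then low else if k == j then high else A k.
have mB k : measurable (B k).
  by rewrite /B; case: ifP => // _; case: ifP => // _; exact: measurableC.
have Bi : B i = low by rewrite /B eqxx.
have Bj : B j = high by rewrite /B eq_sym (negbTE ij) eqxx.
have BF k : k \in F -> B k = A k.
  move=> kF; rewrite /B; case: eqP => [ki|_]; first by rewrite -ki kF in iF.
  by case: eqP => // kj; rewrite -kj kF in jF.
exists B; split=> //.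
- apply/seteqP; split=> w.
  + move=> [wA [wi wj]] k /=; rewrite !inE => /orP[/eqP->|/orP[/eqP->|kF]].
    * by rewrite Bi.
    * by rewrite Bj.
    * by rewrite BF//; exact: wA.
  + move=> wB; split; last first.
      by split; [rewrite -Bi|rewrite -Bj]; apply: wB;
        rewrite /= !inE eqxx ?orbT.
    move=> k /= kF; have := wB k; rewrite BF//; apply.
    by rewrite /= !inE kF !orbT.
- rewrite /cylinder iid.1//; last first.
    by move=> k /=; rewrite !inE => /orP[/eqP->|/orP[/eqP->|/FJ]].
  rewrite iid.1// big_fsetU1/=; last by rewrite !inE negb_or ij.
  rewrite big_fsetU1//= Bi Bj prob_low// prob_high//.
  rewrite (@eq_big_seq _ _ _ _ _ _ (fun k => P (X k @^-1` A k))); last first.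
    by move=> k kF; rewrite BF.
  rewrite muleA -EFinM muleC; congr (_ * _%:E)%E.
  by lra.
Qed.

Variables (i_ j_ : nat -> K).
Hypotheses (Ji : forall n, J (i_ n)) (Jj : forall n, J (j_ n)).
Hypotheses (ij : forall n m, i_ n != j_ m).
Hypotheses (ii : injective i_) (jj : injective j_).

Definition no_split N : set Omega :=
  [set w | forall n, (n < N)%N -> ~ split_event (i_ n) (j_ n) w].

Lemma no_splitS N :
  no_split N.+1 = no_split N `\` split_event (i_ N) (j_ N).
Proof.
apply/seteqP; split=> w.
- by move=> wN; split=> [n nN|]; apply: wN => //; exact: ltnW.
- by move=> [wN wE] n; rewrite ltnS leq_eqVlt => /orP[/eqP->|/wN].
Qed.

Lemma measurable_no_split N : measurable (no_split N).
Proof.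
elim: N => [|N mN]; last first.
  rewrite no_splitS; apply: measurableD => //.
  exact: measurable_split_event.
suff -> : no_split 0 = setT by [].
by apply/seteqP; split.
Qed.

(** Induction on [N], for all cylinders at once: excluding the split event of
    the pair [N] subtracts the probability obtained for the smaller cylinder
    [cylinder F A `&` split_event (i_ N) (j_ N)], which is a quarter of the
    probability obtained for [cylinder F A]. *)
Lemma prob_no_split N F A : [set` F] `<=` J -> (forall k, measurable (A k)) ->
  (forall n, (n < N)%N -> (i_ n \notin F) && (j_ n \notin F)) ->
  P (cylinder F A `&` no_split N) = (((3 / 4) ^+ N)%:E * P (cylinder F A))%E.
Proof.
elim: N F A => [|N IHN] F A FJ mA FN.
  rewrite expr0 mul1e; congr (P _).
  by apply/setIidPl => w _ n.
have mC := measurable_cylinder F mA.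
have mCN : measurable (cylinder F A `&` no_split N).
  by apply: measurableI => //; exact: measurable_no_split.
have mS := measurable_split_event (i_ N) (j_ N).
have PD : P ((cylinder F A `&` no_split N) `\` split_event (i_ N) (j_ N)) =
    (P (cylinder F A `&` no_split N) -
     P (cylinder F A `&` no_split N `&` split_event (i_ N) (j_ N)))%E.
  exact: (measureD mCN mS (le_lt_trans (probability_le1 P mCN) (ltry 1))).
rewrite no_splitS setIDA PD.
have /andP[iF jF] := FN N (ltnSn N).
have [B [mB BE PB]] := cylinder_split_event FJ mA (Ji N) (Jj N) (ij N N) iF jF.
rewrite setIAC BE IHN//; last by move=> n nN; apply: FN; exact: ltnW.
rewrite IHN//; first last.
- move=> n nN; have /andP[inF jnF] := FN n (ltnW nN).
  rewrite !inE !negb_or inF jnF (inj_eq ii) (inj_eq jj) ltn_eqF//.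
  by rewrite (eq_sym (j_ n)) !ij.
- by move=> k /=; rewrite !inE => /orP[/eqP->|/orP[/eqP->|/FJ]].
rewrite PB -(@fineK _ (P (cylinder F A))); last exact: fin_num_measure.
by rewrite -!EFinM -EFinB; congr EFin; rewrite exprS; field.
Qed.

Lemma ae_split_event :
  {ae P, forall w, exists n, X (i_ n) w <= 2^-1 < X (j_ n) w}.
Proof.
have PN N : P (no_split N) = ((3 / 4) ^+ N)%:E.
  have := @prob_no_split N fset0 (fun=> setT).
  have -> : cylinder fset0 (fun=> setT) = setT.
    by apply/seteqP; split=> // w _ k; rewrite /= inE.
  by rewrite setTI probability_setT mule1; apply.
exists (\bigcap_N no_split N); split.
- by apply: bigcapT_measurable => N; exact: measurable_no_split.
- apply/le_anti; rewrite measure_ge0 andbT.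
  have cvg0 : ((3 / 4 : R) ^+ N)%:E @[N --> \oo] --> 0%E.
    apply: cvg_EFin; first exact: nearW.
    by apply: cvg_expr; rewrite ger0_norm; lra.
  apply: (closed_cvg (fun z => P (\bigcap_N no_split N) <= z)%E) cvg0.
    exact: closed_ereal_le_ereal.
  apply: nearW => N; rewrite -PN; apply: le_measure; rewrite ?inE.
  + by apply: bigcapT_measurable => ?; exact: measurable_no_split.
  + exact: measurable_no_split.
  + by move=> w; apply.
- move=> w nw N _ n _ [wi wj]; apply: nw; exists n.
  by move: wi wj; rewrite /= !in_itv/= => -> /negP; rewrite -ltNge => ->.
Qed.

End independent_uniform.

(** * Jumps of a height function *)

Section coded_tree_geometry.
Context {R : realType} (h : height_function R).
Implicit Types (s t u : times h) (x y : coded_tree h).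

Local Notation range_inf a b :=
  (inf [set h r | r in `[Num.min a b, Num.max a b]]).

Lemma range_inf_le s t r :
  r \in `[Num.min (val s) (val t), Num.max (val s) (val t)] ->
  range_inf (val s) (val t) <= h r.
Proof.
move=> rst; apply: ge_inf; last by exists r.
by exists 0; exact: height_interval_lbound.
Qed.

Lemma coded_dist_root t :
  coded_dist (coded_root h) (coded_proj t) = h (val t).
Proof.
have t01 := valP t; have t0 : 0 <= val t by case/andP: (valP t).
rewrite coded_dist_projE /height_dist /= height0 add0r.
set i := inf _; suff -> : i = 0 by rewrite mulr0 subr0.
apply/le_anti/andP; split.
- rewrite -(height0 h).
  apply: (@range_inf_le (exist _ 0 (times0 h)) t).
  by rewrite in_itv/= ge_min le_max lexx.
- apply: lb_le_inf; first exact: height_interval_neq0.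
  exact: (@height_interval_lbound _ h (exist _ 0 (times0 h)) t).
Qed.

Lemma first_time_le t : first_time (coded_proj t) <= val t.
Proof.
apply: ge_inf; first by exists 0 => _ [s _ <-]; case/andP: (valP s).
by exists t.
Qed.

Lemma first_time_lt x (a : R) : first_time x < a ->
  exists2 s, coded_proj s = x & val s < a.
Proof.
move=> xa.
have inf_x : has_inf (coded_proj_preimage [set x]).
  split; last by exists 0 => _ [s _ <-]; case/andP: (valP s).
  by exists (val (repr x)); exists (repr x) => //=; exact: reprK.
have a0 : 0 < a - first_time x by rewrite subr_gt0.
have [_ [s /= sx <-]] := inf_adherent a0 inf_x.
by rewrite /first_time in a0 *; rewrite addrC subrK; exists s.
Qed.

(** What a jump at time [t] from [h t] down to [g] means in the coded tree. A
    time [u] of [y] comes after some time [s] of the point coded by [t]. If [u]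
    is at most [t], it lies between two times of that point, where [h] stays
    above [h t]: then [y] is a descendant. If [u] is larger than [t], then the
    infimum of [h] between [t] and [u] is at most [g]. *)
Lemma jump_separates t y (g : R) : val t < zeta h ->
  h @ (val t)^'+ --> g ->
  first_time (coded_proj t) < first_time y ->
  coded_dist (coded_proj t) y <= coded_dist (coded_root h) y - h (val t) \/
  h (val t) + coded_dist (coded_root h) y - 2 * g <=
    coded_dist (coded_proj t) y.
Proof.
move=> tz hg ft; have yE : coded_proj (repr y) = y by exact: reprK.
set u := repr y in yE.
have [s st su] := first_time_lt ft.
have {}su : val s < val u.
  by apply: lt_le_trans su _; rewrite -yE; exact: first_time_le.
rewrite -yE coded_dist_root coded_dist_projE.
have [ut|tu] := leP (val u) (val t); [left|right].
- rewrite /height_dist (min_idPr ut) (max_idPl ut).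
  suff : h (val t) <= inf [set h r | r in `[val u, val t]] by lra.
  have sts : height_dist h (val s) (val t) = 0.
    by rewrite -coded_dist_projE st coded_distxx.
  have tinf : h (val t) = range_inf (val s) (val t).
    have h1 : range_inf (val s) (val t) <= h (val s).
      by apply: range_inf_le; rewrite in_itv/= ge_min le_max !lexx.
    have h2 : range_inf (val s) (val t) <= h (val t).
      by apply: range_inf_le; rewrite in_itv/= ge_min le_max !lexx !orbT.
    by move: sts; rewrite /height_dist; lra.
  apply: lb_le_inf.
    by exists (h (val t)), (val t) => //; rewrite /= in_itv/= lexx ut.
  move=> z [r /=]; rewrite in_itv/= => /andP[ur rt] <-.
  rewrite tinf; apply: range_inf_le.
  rewrite in_itv/= ge_min le_max rt orbT andbT.
  by rewrite (le_trans (ltW su) ur).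
- have -> : height_dist h (val t) (val u) =
      h (val t) + h (val u) - 2 * range_inf (val t) (val u) by [].
  suff : range_inf (val t) (val u) <= g by lra.
  apply: (closed_cvg (fun z => range_inf (val t) (val u) <= z)) hg.
  + exact: closed_ge.
  + near=> r; apply: range_inf_le.
    rewrite in_itv/= (min_idPl (ltW tu)) (max_idPr (ltW tu)).
    apply/andP; split; near: r; [exact: nbhs_right_ge | exact: nbhs_right_le].
Unshelve. all: by end_near. Qed.

Lemma discontinuous_jump : ~ {within `[0, zeta h], continuous h} ->
  exists t (g : R),
    [/\ val t < zeta h, h @ (val t)^'+ --> g & 0 <= g < h (val t)].
Proof.
move=> nc; apply: contrapT => nj; apply: nc.
have [z0|z0] := leP (zeta h) 0.
  have -> : zeta h = 0 by apply/le_anti; rewrite z0 zeta_ge0.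
  by rewrite set_itv1; exact: continuous_subspace1.
have right (t : R) : 0 <= t < zeta h -> h @ t^'+ --> h t.
  move=> /andP[t0 tz]; have t0z : 0 <= t < zeta h by rewrite t0.
  have tz' : 0 <= t <= zeta h by rewrite t0 ltW.
  pose g : R := lim (h @ t^'+).
  have hg : h @ t^'+ --> g by exact: height_right_lim.
  suff -> : h t = g by [].
  have := height_jump t0z; rewrite -/g subr_ge0 => gh; clearbody g.
  apply/le_anti/andP; split=> //.
  rewrite leNgt; apply/negP => gt; apply: nj; exists (exist _ t tz'), g.
  rewrite /= gt andbT; split=> //.
  apply: (closed_cvg (fun z : R => 0 <= z)) hg; first exact: closed_ge.
  near=> r; apply: height_ge0; apply/andP; split.
    by apply: le_trans t0 _; near: r; exact: nbhs_right_ge.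
  by near: r; exact: nbhs_right_le.
apply/continuous_within_itvP => //; split.
- move=> t; rewrite in_itv/= => /andP[t0 tz].
  apply/left_right_continuousP; split; last by apply: right; rewrite ltW.
  by apply: height_left_cont; rewrite t0 ltW.
- by apply: right; rewrite lexx.
- by apply: height_left_cont; rewrite z0 lexx.
Unshelve. all: by end_near. Qed.

End coded_tree_geometry.

(** * Shuffles along a segment *)

Section fork.
Context {R : realType} {T : metricType R}.
Hypothesis tree : real_tree T.
Variables (rho : T) (I : T -> set nat) (C : T -> nat -> set T).
Hypothesis labels : subtree_labelling rho I C.
Hypothesis dense : closure (leaves rho) = [set: T].

(** The subtrees [k] and [k'] at [b] are the two whose shuffle is compared: [k]
    contains [x], and [k'] branches off the segment from [rho] to [x]. *)
Definition fork (x b : T) (k k' : nat) : Prop :=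
  [/\ branch_points rho b, I b k /\ I b k', k <> k', C b k x & C b k' !=set0].

Lemma exists_fork x (s t : R) : 0 <= s -> s < t -> t <= mdist rho x ->
  exists b k k', s < mdist rho b < t /\ fork x b k k'.
Proof.
move=> s0 st tx.
have [b [l [sbt bx bl xl lb]]] := exists_branch tree dense s0 st tx.
have rb : rho <> b by move=> rb; move: sbt; rewrite rb mdistxx; lra.
have xb : x <> b by move=> xb; move: sbt; rewrite -xb; lra.
have [k Ik Cx] := label_of_point tree labels rb xb bx.
have [k' Ik' Cl] := label_of_point tree labels rb lb bl.
exists b, k, k'; split=> //; split=> //; last by exists l.
  exact: branch_pointI rb xb lb bx bl xl.
move=> kk'; rewrite -kk' in Cl.
have [_ E _] := label_component tree labels Ik Cx.
by move: Cl; rewrite E => /(separation tree); apply.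
Qed.

(** A point [z] closer to [x] than [b] is lies in the subtree [k] too, so the
    shuffle at [b] places the points of the subtree [k'] after [z]. *)
Lemma fork_not_le x b k k' (u : T * nat -> R) z : fork x b k k' ->
  u (b, k) < u (b, k') -> mdist x z < mdist x b ->
  exists y,
    [/\ ~ shuffle_le rho I C u y z, btw rho b y, btw rho b z & btw z b y].
Proof.
move=> [[br _] [Ik Ik'] kk' Cx [y Cy]] u_lt zx.
have rb : rho <> b by exact: nesym.
have [xb E _] := label_component tree labels Ik Cx.
have Cz : C b k z.
  rewrite E; apply/(separation tree) => //.
    by move=> zb; move: zx; rewrite zb ltxx.
  by rewrite /btw; have := mdist_ge0 b z; lra.
exists y; split.
- move=> /(shuffle_le_label tree labels rb Ik' Ik (nesym kk') Cy Cz).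
  by rewrite leNgt u_lt.
- by have [_ _] := label_component tree labels Ik' Cy; apply.
- by have [_ _] := label_component tree labels Ik Cz; apply.
- exact: label_btw Ik Ik' kk' Cz Cy.
Qed.

(** The heights [s + (t - s) / n.+1] cut the piece of segment into infinitely
    many disjoint pieces. Forks chosen in different pieces have different branch
    points, so that they involve pairwise distinct uniform variables. *)
Lemma ae_fork d (Omega : measurableType d) (P : probability Omega R)
    (U : T * nat -> {RV P >-> R}) x (s t : R) :
  iid_uniform (shuffle_index rho I) U ->
  0 <= s -> s < t -> t <= mdist rho x ->
  {ae P, forall w, exists b k k',
    [/\ s < mdist rho b < t, fork x b k k' & U (b, k) w < U (b, k') w]}.
Proof.
move=> iid s0 st tx.
pose a n := s + (t - s) / n.+1%:R.
have a_lt m n : (m < n)%N -> a n < a m.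
  move=> mn; rewrite /a ltrD2l ltr_pM2l ?subr_gt0//.
  by rewrite ltf_pV2 ?posrE ?ltr0n// ltr_nat ltnS.
have a_gt n : s < a n by rewrite /a ltrDl divr_gt0 ?subr_gt0.
have a_le n : a n <= t.
  have -> : t = a 0 by rewrite /a divr1; lra.
  by case: n => // n; apply: ltW; exact: a_lt.
have /choice[c cP] : forall n, exists c : T * (nat * nat),
    a n.+1 < mdist rho c.1 < a n /\ fork x c.1 c.2.1 c.2.2.
  move=> n; have [b [k [k' bkk']]] := exists_fork
    (le_trans s0 (ltW (a_gt n.+1))) (a_lt n n.+1 (ltnSn n))
    (le_trans (a_le n) tx).
  by exists (b, (k, k')).
have c_lt m n : (m < n)%N -> mdist rho (c n).1 < mdist rho (c m).1.
  move=> mn; have [/andP[_ cn] _] := cP n; have [/andP[cm _] _] := cP m.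
  apply: lt_trans cn (le_lt_trans _ cm).
  by move: mn; rewrite -ltnS ltnS leq_eqVlt => /orP[/eqP->//|/a_lt/ltW].
have c_inj m n : (c m).1 = (c n).1 -> m = n.
  move=> cmn; case: (ltngtP m n) => // /c_lt; by rewrite cmn ltxx.
have := @ae_split_event _ _ _ _ _ _ U iid (fun n => ((c n).1, (c n).2.1))
  (fun n => ((c n).1, (c n).2.2)).
have idx1 n : shuffle_index rho I ((c n).1, (c n).2.1).
  by have [_ [br [Ik _] _ _ _]] := cP n; split=> //; left.
have idx2 n : shuffle_index rho I ((c n).1, (c n).2.2).
  by have [_ [br [_ Ik] _ _ _]] := cP n; split=> //; left.
move=> /(_ idx1 idx2) ae_c.
have {}ae_c : {ae P, forall w, exists n : nat,
    U ((c n).1, (c n).2.1) w <= 2^-1 < U ((c n).1, (c n).2.2) w}.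
  apply: ae_c.
  - move=> n m; apply/eqP => -[/c_inj <-].
    by have [_ [_ _ kk' _ _]] := cP n.
  - by move=> m n [/c_inj].
  - by move=> m n [/c_inj].
apply: filterS ae_c => w [n /andP[u1 u2]].
have [/andP[c1 c2] fk] := cP n.
exists (c n).1, (c n).2.1, (c n).2.2; split=> //; last exact: le_lt_trans u1 u2.
by rewrite (lt_trans (a_gt _) c1) (lt_le_trans c2 (a_le _)).
Qed.

End fork.

(** * Continuity of the height function of a shuffled tree *)

(** Otherwise the complements of the finite unions of balls would generate a
    proper filter without a cluster point. *)
Lemma compact_net (R : realType) (T : metricType R) (x0 : T) n :
  compact [set: T] -> exists F : seq T, forall y,
    exists2 i, (i < size F)%N & mdist (nth x0 F i) y < n.+1%:R^-1.
Proof.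
move=> cT; set e : R := n.+1%:R^-1; apply: contrapT => nF.
pose far (F : seq T) := [set y | forall x, x \in F -> e <= mdist x y].
have far_neq0 F : far F !=set0.
  apply: contrapT => F0; apply: nF; exists F => y; apply: contrapT => yF.
  apply: F0; exists y => x xF; rewrite leNgt; apply/negP => xy; apply: yF.
  by exists (index x F); rewrite ?index_mem ?nth_index.
pose G : set_system T := filter_from setT far.
have GF : ProperFilter G.
  apply: filter_from_proper; last by move=> F _; exact: far_neq0.
  apply: filter_from_filter; first by exists [::].
  move=> F F' _ _; exists (F ++ F') => // y yFF'.
  by split=> x xF; apply: yFF'; rewrite mem_cat xF ?orbT.
have [p [_ pG]] := cT G GF (filterT).
have e0 : 0 < e by rewrite invr_gt0.
have [] := pG (far [:: p]) (ball p e).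
- by exists [:: p].
- exact: nbhsx_ballx.
- move=> y [/(_ p)]; rewrite mem_head => /(_ isT) + py.
  by move: py; rewrite ballEmdist/= ltNge => /negP.
Qed.

Lemma ae_forall_countable d (Omega : measurableType d) (R : realType)
    (P : {measure set Omega -> \bar R}) (K : countType)
    (Q : K -> Omega -> Prop) :
  (forall k, {ae P, forall w, Q k w}) -> {ae P, forall w, forall k, Q k w}.
Proof.
move=> aeQ.
have : {ae P, forall w, forall n,
    if @choice.unpickle K n is Some k then Q k w else True}.
  apply/ae_foralln => n; case: (choice.unpickle n) => [k|]; first exact: aeQ.
  exact: aeW.
apply: filterS => w Qw k.
by have := Qw (choice.pickle k); rewrite choice.pickleK.
Qed.

Unset Implicit Arguments.

Theorem proposition4p3 (R : realType) (T : metricType R) (rho : T)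
    (T_tree : real_tree T) (T_compact : compact [set: T])
    (T_leaves : closure (leaves rho) = [set: T])
    (I : T -> set nat) (C : T -> nat -> set T)
    (C_labels : subtree_labelling rho I C)
    (d : measure_display) (Omega : measurableType d) (P : probability Omega R)
    (U : T * nat -> {RV P >-> R})
    (U_iid : iid_uniform (shuffle_index rho I) U) :
  {ae P, forall w : Omega,
    forall mu : {finite_measure set (borel rho) -> \bar R},
      topological_support (mu : set T -> \bar R) = [set: T] ->
      forall h : height_function R,
        height_function_of
          (@StructuredSpace R T rho
             (shuffle_le rho I C (fun i => U i w)) (mu : set T -> \bar R)) h ->
        {within `[0, zeta h], continuous h}}.
Proof.
(* F lists, for each n, a finite net of mesh 1 / n.+1. *)
have /choice[F FP] := compact_net rho ^~ T_compact.
have aeU : {ae P, forall w, forall c : nat * nat * (rat * rat),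
    let x := nth rho (F c.1.1) c.1.2 in
    let s := ratr c.2.1 in let t := ratr c.2.2 in
    0 <= s -> s < t -> t <= mdist rho x ->
    exists b k k', [/\ s < mdist rho b < t, fork rho I C x b k k' &
                      U (b, k) w < U (b, k') w]}.
  apply: ae_forall_countable => -[[n i] [q r]] /=.
  have [/and3P[s0 st tx]|nP] := boolP [&& 0 <= ratr q :> R, ratr q < ratr r :> R
    & ratr r <= mdist rho (nth rho (F n) i)].
    have := ae_fork T_tree C_labels T_leaves U_iid s0 st tx.
    by apply: filterS => w Hw _ _ _; exact: Hw.
  by apply: aeW => w s0 st tx; rewrite s0 st tx in nP.
apply: filterS aeU => w Uw mu _ h [_ [f [f_iso f_onto f_root f_le _]]].
apply: contrapT => /discontinuous_jump[t [g [tz hg /andP[g0 gt]]]].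
pose z : T := f (coded_proj t).
have hz : mdist rho z = h (val t).
  by rewrite -(coded_dist_root t) -[RHS]f_iso f_root.
(* A point x at distance less than e from z has height more than h(t) - e, so
   it is at distance more than e from the points of its ancestral line at
   height less than h(t) - 2 e. *)
pose e : R := (h (val t) - g) / 4.
have e0 : 0 < e by rewrite /e; lra.
have [n ne] : exists n : nat, n.+1%:R^-1 < e.
  have [N _ N_lt] := near_infty_natSinv_lt (PosNum e0).
  by exists N; exact: (N_lt N (leqnn N)).
have [i _] := FP n z; set x := nth _ _ _ => /lt_trans/(_ ne) xz.
have rat_between (u v : R) :
    u < v -> exists q : rat, u < ratr q :> R /\ ratr q < v :> R.
  by move=> /rat_in_itvoo[q]; rewrite in_itv/= => /andP[uq qv]; exists q.
have [q [gq qh]] : exists q : rat,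
    g < ratr q :> R /\ ratr q < h (val t) - 2 * e :> R.
  by apply: rat_between; rewrite /e; lra.
have [r [qr rh]] := rat_between _ _ qh.
have rx := metric_triangle rho x z.
have q0 : 0 <= ratr q :> R by lra.
have rx' : ratr r <= mdist rho x by lra.
have [b [k [k' [/andP[qb br] fk ult]]]] := Uw (n, i, (q, r)) q0 qr rx'.
rewrite /= -/x in qb br fk.
have rxb := metric_triangle rho b x.
have xzb : mdist x z < mdist x b.
  by rewrite (metric_sym b x) in rxb; lra.
have [y [yz ry rz zy]] :=
  fork_not_le T_tree C_labels (u := fun i => U i w) fk ult xzb.
have [y0 _ fy] := f_onto y Logic.I.
have ft : first_time (coded_proj t) < first_time y0.
  rewrite ltNge; apply/negP => le_y; apply: yz; rewrite -fy.
  exact: f_le.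
have dzy : coded_dist (coded_proj t) y0 = mdist z y.
  by rewrite -fy; exact/esym/f_iso.
have hy : coded_dist (coded_root h) y0 = mdist rho y.
  exact: etrans (esym (f_iso _ _)) (congr2 mdist f_root fy).
have := jump_separates tz hg ft; rewrite dzy hy.
by move: ry rz zy; rewrite /btw (metric_sym z b); lra.
Qed.
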